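(* Let $\mathbf{k}=(k_1,\ldots,k_r)$ and $\mathbf{l}=(l_1,\ldots,l_s)$ be admissible indices of depths $r,s\ge1$. Then \[ \lim_{x\to1^-}\Big\{{\rm A}(\mathbf{k};x){\rm A}(\mathbf{l},1;x)-{\rm A}(\mathbf{k},1;x){\rm A}(\mathbf{l};x)\Big\}=T(\mathbf{l})T(\mathbf{k}^-\circledast(1,1))-T(\mathbf{k})T(\mathbf{l}^-\circledast(1,1))+2\delta_{r,s}\log(2)T(\mathbf{k})T(\mathbf{l}). \]
   Context: An index $(c_1,\ldots,c_d)$ of positive integers is admissible if $c_d\ge2$. ${\rm A}(c_1,\ldots,c_d;z)=2^d\sum_{1\le n_1<\cdots<n_d,\ n_i\equiv i \pmod 2}\frac{z^{n_d}}{n_1^{c_1}\cdots n_d^{c_d}}$ for $z\in[-1,1)$; $(\mathbf{k},1)$ denotes $(k_1,\ldots,k_r,1)$. For admissible $\mathbf{c}$, $T(\mathbf{c})=2^d\sum_{0<m_1<\cdots<m_d,\ m_i\equiv i\pmod 2}\frac{1}{m_1^{c_1}\cdots m_d^{c_d}}$. $\mathbf{c}^-=(c_1,\ldots,c_{d-1},c_d-1)$. Multiple $T$-harmonic sums: $T_n(\emptyset)=1$; $T_n(c_1,\ldots,c_{2m-1})=2\sum_{j=1}^n\frac{T_j(c_1,\ldots,c_{2m-2})}{(2j-1)^{c_{2m-1}}}$; $T_n(c_1,\ldots,c_{2m})=2\sum_{j=1}^{n-1}\frac{T_j(c_1,\ldots,c_{2m-1})}{(2j)^{c_{2m}}}$;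 so $T_n(1)=\sum_{j=1}^n\frac{2}{2j-1}$; let $S_n(1)=\sum_{j=1}^{n-1}\frac{2}{2j}$. For $\mathbf{c}=(c_1,\ldots,c_d)$: $T(\mathbf{c}\circledast(1,1))=2\sum_{n\ge1}\frac{T_n(c_1,\ldots,c_{d-1})T_n(1)}{(2n)^{c_d+1}}$ if $d$ is even, and $=2\sum_{n\ge1}\frac{T_n(c_1,\ldots,c_{d-1})S_n(1)}{(2n-1)^{c_d+1}}$ if $d$ is odd. $\delta_{r,s}=0$ if $r,s$ have the same parity, $-1$ if $r$ even and $s$ odd, $1$ if $r$ odd and $s$ even. *)

(* Defs.v *)
From HB Require Import structures.
From mathcomp Require Import all_boot all_order all_algebra.
From mathcomp Require Import all_classical all_reals all_analysis.

Set Implicit Arguments.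
Unset Strict Implicit.
Unset Printing Implicit Defensive.

Import Order.TTheory GRing.Theory Num.Theory.
Import numFieldNormedType.Exports.

Local Open Scope ring_scope.

(* An index (c_1, ..., c_d) is the sequence [:: c_1; ...; c_d], so that c_i is
   nth 0 c i.-1, and c_d is last 0 c when d >= 1. *)

Definition admissible (c : seq nat) : bool :=
  all (leq 1) c && (2 <= last 0 c)%N.

(* 1 <= n_1 < ... < n_d and n_i = i modulo 2; positions are counted from 0. *)
Definition alternating (n : seq nat) : bool :=
  path ltn 0 n && [forall i : 'I_(size n), odd (nth 0%N n i) == odd i.+1].

Definition zeta_monomial (R : realType) (c n : seq nat) : R :=
  \prod_(i < size c) (nth 0%N n i)%:R ^+ nth 0%N c i.

(* The series over n_1 < ... < n_d is ordered by the largest summation variable: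
   it is the limit of its partial sums over n_d < N. This matters only where
   convergence is conditional. *)
Definition Afun (R : realType) (c : seq nat) (z : R) : R :=
  limn (fun N : nat => 2 ^+ size c *
    \sum_(t : (size c).-tuple 'I_N | alternating (map val t))
       z ^+ last 0%N (map val t) / zeta_monomial R c (map val t)).

Definition Tval (R : realType) (c : seq nat) : R :=
  limn (fun N : nat => 2 ^+ size c *
    \sum_(t : (size c).-tuple 'I_N | alternating (map val t))
       1 / zeta_monomial R c (map val t)).

Definition decr_last (c : seq nat) : seq nat :=
  set_nth 0%N c (size c).-1 (last 0%N c).-1.

(* The recursion removes the last entry of the index, hence runs on its
   reversal: Tsum_rev [:: c_d; ...; c_1] j is T_j(c_1, ..., c_d). *)
Fixpoint Tsum_rev (R : realType) (rc : seq nat) (m : nat) : R :=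
  if rc is e :: rc' then
    if odd (size rc) then
      2 * \sum_(1 <= j < m.+1) Tsum_rev R rc' j / (2 * j%:R - 1) ^+ e
    else
      2 * \sum_(1 <= j < m) Tsum_rev R rc' j / (2 * j%:R) ^+ e
  else 1.

Definition Tsum (R : realType) (m : nat) (c : seq nat) : R := Tsum_rev R (rev c) m.

Definition Ssum1 (R : realType) (m : nat) : R := \sum_(1 <= j < m) 2 / (2 * j%:R).

(* The value T(c \circledast (1,1)), for a nonempty index c. *)
Definition T_circledast11 (R : realType) (c : seq nat) : R :=
  let c' := take (size c).-1 c in
  let e := (last 0%N c).+1 in
  if odd (size c) then
    2 * limn (fun N : nat => \sum_(1 <= m < N)
      Tsum R m c' * Ssum1 R m / (2 * m%:R - 1) ^+ e)
  else
    2 * limn (fun N : nat => \sum_(1 <= m < N)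
      Tsum R m c' * Tsum R m [:: 1%N] / (2 * m%:R) ^+ e).

Definition delta (R : realType) (r s : nat) : R :=
  if odd r == odd s then 0 else if odd r then 1 else -1.

(* Main.v *)
(* Write A(k;x) = sum_n a_n x^n. Then A(k,1;x) = sum_m b_m x^m sum_(n<m) a_n, where
   b_m = 2/m for m of the parity opposite to r and 0 otherwise, and completing the
   inner sum gives A(k,1;x) = T(k) L_r(x) - D_k(x) with L_r(x) = sum_m b_m x^m and
   D_k(x) = sum_n a_n sum_(m<n) b_m x^m. Dominated convergence yields
   D_k(x) -> T(k^- o (1,1)); it also yields (T(k) - A(k;x)) L(x) -> 0, because
   L(x) (1 - x^n) is bounded by a harmonic sum H_n, and sum_n a_n H_n converges
   since a_n = O(H_n^(r-1) / n^2). The logarithmic singularities thus cancel,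
   except for T(k) T(l) (L_s(x) - L_r(x)), where L_s - L_r = 2 delta log(1+x). *)

Require Import Defs.
From HB Require Import structures.
From mathcomp Require Import all_boot all_order all_algebra.
From mathcomp Require Import all_classical all_reals all_analysis.
From mathcomp Require Import zify ring lra.

Set Implicit Arguments.
Unset Strict Implicit.
Unset Printing Implicit Defensive.

Import Order.TTheory GRing.Theory Num.Theory.
Import numFieldNormedType.Exports.

Local Open Scope classical_set_scope.
Local Open Scope ring_scope.

(** * Reduction of the multiple sums to iterated simple sums *)

(* The weights vanish at [m = 0], so junk values of [2 / 0] never occur. *)
Definition weight (R : realType) (d e m : nat) : R :=
  if (0 < m)%N && (odd m == odd d) then 2 / m%:R ^+ e else 0.

(* As in [Tsum_rev], the index is reversed: the head is the exponent of the
   largest summation variable, which here ranges below [m] itself. *)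
Fixpoint nested (R : realType) (rc : seq nat) : nat -> R :=
  if rc is e :: rc' then
    series (fun j => weight R (size rc) e j * nested R rc' j)
  else fun=> 1.

(** Coefficient of z^m in A(c;z), for [rc] the reversal of c: it collects the tuples with largest
    entry [m]. *)
Definition term (R : realType) (rc : seq nat) (m : nat) : R :=
  if rc is e :: rc' then weight R (size rc) e m * nested R rc' m else 0.

Lemma nested_term (R : realType) (rc : seq nat) :
  (0 < size rc)%N -> nested R rc = series (term R rc).
Proof. by case: rc. Qed.

Lemma alternating_rcons (n : seq nat) (m : nat) :
  Defs.alternating (rcons n m) =
  [&& Defs.alternating n, (last 0 n < m)%N & odd m == odd (size n).+1].
Proof.
rewrite /Defs.alternating rcons_path -!andbA; congr (_ && _).
rewrite andbCA; congr (_ && _).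
apply/forallP/andP => [H|[/forallP H1 /eqP H2] [i Hi]].
  split; last first.
    have Hn : (size n < size (rcons n m))%N by rewrite size_rcons.
    by have := H (Ordinal Hn); rewrite /= nth_rcons ltnn eqxx.
  apply/forallP => -[i Hi]; have Hi' : (i < size (rcons n m))%N.
    by rewrite size_rcons ltnW.
  by have := H (Ordinal Hi'); rewrite /= nth_rcons Hi.
rewrite /= nth_rcons; case: ltngtP => [lin||->]; first exact: (H1 (Ordinal lin)).
  by move: Hi; rewrite size_rcons => + lin; lia.
by rewrite H2.
Qed.

Lemma zeta_monomial_rcons (R : realType) (c n : seq nat) (e m : nat) :
  size n = size c ->
  zeta_monomial R (rcons c e) (rcons n m) = zeta_monomial R c n * m%:R ^+ e.
Proof.
move=> Hs; rewrite /zeta_monomial size_rcons big_ord_recr /=.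
rewrite !nth_rcons Hs ltnn eqxx; congr (_ * _).
by apply: eq_bigr => i _; rewrite !nth_rcons Hs ltn_ord.
Qed.

Lemma sum_tuple_rcons (V : nmodType) (T : finType) (d : nat) (P : pred (seq T))
    (F : seq T -> V) :
  \sum_(t : d.+1.-tuple T | P t) F t =
  \sum_(t : d.-tuple T) \sum_(i : T | P (rcons t i)) F (rcons t i).
Proof.
rewrite pair_big_dep /=.
rewrite (reindex (fun p : d.-tuple T * T => [tuple of rcons p.1 p.2])) //=.
exists (fun t => ([tuple of belast (thead t) (behead t)],
                  last (thead t) (behead t))) => [[t i] _|t _] /=.
  congr (_, _); last first.
    by rewrite /thead (tnth_nth i); case: t => -[|x t] Ht //=; rewrite last_rcons.
  apply: val_inj; rewrite /thead (tnth_nth i) /=.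
  by case: t => -[|x t] Ht //=; rewrite belast_rcons.
apply: val_inj => /=; rewrite -lastI.
by case/tupleP: t => x t; rewrite theadE.
Qed.

(** The inner sums enter as a hypothesis, so that the lemma serves both inside the induction, with
    [g] a cutoff, and after it, with [g] a power of z or the constant 1. *)
Lemma sum_alternating_rcons (R : realType) (c : seq nat) (e d N : nat)
    (g : nat -> R) :
  size c = d ->
  (forall M : nat, (M < N)%N -> (0 < M)%N ->
     2 ^+ d * \sum_(t : d.-tuple 'I_N |
         Defs.alternating (map val t) && (last 0 (map val t) < M)%N)
       1 / zeta_monomial R c (map val t) = nested R (rev c) M) ->
  2 ^+ d.+1 * \sum_(t : d.+1.-tuple 'I_N | Defs.alternating (map val t))
      g (last 0%N (map val t)) / zeta_monomial R (rcons c e) (map val t)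
    = \sum_(0 <= j < N) term R (rev (rcons c e)) j * g j.
Proof.
move=> Hd Hc.
rewrite (sum_tuple_rcons _ (fun t => Defs.alternating (map val t)) (fun t =>
  g (last 0%N (map val t)) / zeta_monomial R (rcons c e) (map val t))) /=.
under eq_bigr => t _ do under eq_bigl => i do
  rewrite map_rcons alternating_rcons size_map size_tuple andbA.
rewrite (exchange_big_dep predT) //= big_mkord mulr_sumr; apply: eq_bigr => i _.
rewrite rev_rcons /= /weight size_rev Hd.
have [i0|i0] := posnP i.
  rewrite i0 /= big_pred0 ?mulr0 ?mul0r // => t.
  by rewrite ltn0 andbF.
rewrite /=; case: ifP => _ /=; last first.
  rewrite big_pred0 ?mulr0 ?mul0r // => t.
  by rewrite !andbF.
under eq_bigl => t do rewrite andbT.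
rewrite -(Hc i) // exprS !mulr_sumr mulr_suml; apply: eq_bigr => t _.
rewrite map_rcons last_rcons zeta_monomial_rcons ?size_map ?size_tuple //.
rewrite invfM; ring.
Qed.

(** [0 < M] matters for the empty index, whose last entry defaults to 0; [M <= N] keeps the range
    ['I_N] from truncating the sum. *)
Lemma nested_tuple (R : realType) (c : seq nat) (N M : nat) :
  (0 < M)%N -> (M <= N)%N ->
  2 ^+ size c * \sum_(t : (size c).-tuple 'I_N |
         Defs.alternating (map val t) && (last 0 (map val t) < M)%N)
       1 / zeta_monomial R c (map val t) = nested R (rev c) M.
Proof.
elim/last_ind: c M => [|c e IH] M M0 MN.
  rewrite expr0 mul1r (big_pred1 [tuple]) => [|t].
    by rewrite /zeta_monomial big_ord0 divr1.
  rewrite (tuple0 t) [RHS]eqxx /= M0 andbT.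
  by apply/andP; split => //; apply/forallP => -[].
rewrite size_rcons.
(* The cutoff below [M] becomes a 0-1 factor in the largest variable. *)
transitivity (\sum_(0 <= j < N) term R (rev (rcons c e)) j * (j < M)%:R : R).
  rewrite -(@sum_alternating_rcons R c e (size c) N (fun j => (j < M)%:R)) //;
    last by move=> M' M'N M'0; apply: IH => //; exact: ltnW.
  congr (_ * _); rewrite [RHS]big_mkcond [LHS]big_mkcond /=.
  apply: eq_bigr => t _; case: Defs.alternating => //=.
  by case: ifP => _; rewrite ?mul0r.
rewrite nested_term ?size_rev ?size_rcons // [RHS]/series /=.
rewrite (big_cat_nat (leq0n M) MN) /= [X in _ + X]big_nat_cond.
rewrite [X in _ + X]big1 ?addr0; last first.
  by move=> j /andP[/andP[Mj _] _]; rewrite ltnNge Mj mulr0.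
by apply: eq_big_nat => j /andP[_ ->]; rewrite mulr1.
Qed.

Lemma sum_alternating (R : realType) (c : seq nat) (N : nat) (g : nat -> R) :
  (0 < size c)%N ->
  2 ^+ size c * \sum_(t : (size c).-tuple 'I_N | Defs.alternating (map val t))
      g (last 0%N (map val t)) / zeta_monomial R c (map val t)
    = series (fun j => term R (rev c) j * g j) N.
Proof.
case/lastP: c => [//|c e] _; rewrite size_rcons.
apply: sum_alternating_rcons => // M MN M0; exact: nested_tuple M0 (ltnW MN).
Qed.

Lemma AfunE (R : realType) (c : seq nat) (x : R) : (0 < size c)%N ->
  Afun c x = limn (series (fun j => term R (rev c) j * x ^+ j)).
Proof.
move=> c0; rewrite /Afun; apply: (congr1 (fun u : R^nat => limn u)); apply/funext => N.
exact: (@sum_alternating R c N (fun j => x ^+ j)).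
Qed.

Lemma TvalE (R : realType) (c : seq nat) : (0 < size c)%N ->
  Tval R c = limn (series (term R (rev c))).
Proof.
move=> c0; rewrite /Tval; apply: (congr1 (fun u : R^nat => limn u)); apply/funext => N.
rewrite (@sum_alternating R c N (fun=> 1)) //.
by congr (series _ N); apply/funext => j; rewrite mulr1.
Qed.

(** * Splitting by parity and the multiple T-harmonic sums *)

Lemma sum_odd_below (V : nmodType) (f : nat -> V) (n : nat) :
  (forall m, ~~ odd m -> f m = 0) ->
  \sum_(0 <= m < n.*2) f m = \sum_(1 <= j < n.+1) f (j.*2.-1).
Proof.
move=> f0; elim: n => [|n IH]; first by rewrite !big_geq.
rewrite doubleS big_nat_recr // big_nat_recr //= IH [RHS]big_nat_recr //=.
by rewrite (f0 n.*2) ?odd_double // addr0.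
Qed.

Lemma sum_even_below (V : nmodType) (f : nat -> V) (n : nat) :
  (forall m, odd m || (m == 0)%N -> f m = 0) ->
  \sum_(0 <= m < n.*2.-1) f m = \sum_(1 <= j < n) f j.*2.
Proof.
move=> f0; case: n => [|n]; first by rewrite !big_geq.
elim: n => [|n IH]; first by rewrite big_nat1 f0 // big_geq.
rewrite doubleS /= big_nat_recr // big_nat_recr //= -[n.*2.+1]/(n.+1.*2.-1) IH.
by rewrite [RHS]big_nat_recr //= (f0 n.*2.+1) /= ?odd_double // addr0.
Qed.

Lemma natr_double_pred (R : pzRingType) (j : nat) : (0 < j)%N ->
  (j.*2.-1)%:R = 2 * j%:R - 1 :> R.
Proof.
case: j => // j _; rewrite doubleS /= -natrM mul2n doubleS -[LHS]addr0.
by rewrite -[j.*2.+2]addn1 natrD addrK addr0.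
Qed.

Lemma series_weight_odd (R : realType) (d e m : nat) (f : nat -> R) : odd d ->
  series (fun j => weight R d e j * f j) m.*2 =
  2 * \sum_(1 <= j < m.+1) f j.*2.-1 / (2 * j%:R - 1) ^+ e.
Proof.
move=> od; rewrite /series /= sum_odd_below => [|j /negbTE oj]; last first.
  by rewrite /weight oj od andbF mul0r.
rewrite mulr_sumr; apply: eq_big_nat => j /andP[j0 _].
rewrite /weight natr_double_pred // od.
have -> : (0 < j.*2.-1)%N by lia.
have -> : odd j.*2.-1 by lia.
by rewrite /= mulrAC mulrA.
Qed.

Lemma series_weight_even (R : realType) (d e m : nat) (f : nat -> R) :
  ~~ odd d ->
  series (fun j => weight R d e j * f j) m.*2.-1 =
  2 * \sum_(1 <= j < m) f j.*2 / (2 * j%:R) ^+ e.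
Proof.
move=> /negbTE od; rewrite /series /= sum_even_below => [|j oj]; last first.
  rewrite /weight od; case: j oj => [|j] /=; rewrite ?mul0r ?orbF // => ->.
  by rewrite mul0r.
rewrite mulr_sumr; apply: eq_big_nat => j /andP[j0 _].
rewrite /weight -mul2n natrM od mul2n odd_double eqxx double_gt0 j0 /=.
by rewrite mulrAC mulrA.
Qed.

(** T_n is a nested sum cut off at the value of the next outer variable: 2n above an odd depth, 2n-1
    above an even one. This is how the ranges j <= n and j < n both express a strict inequality
    between variables. *)
Lemma Tsum_rev_nested (R : realType) (rc : seq nat) (m : nat) :
  Tsum_rev R rc m = nested R rc (if odd (size rc) then m.*2 else m.*2.-1).
Proof.
elim: rc m => [//|e rc IH] m; rewrite /=.
case: ifPn => os.
  rewrite series_weight_odd //; congr (2 * _); apply: eq_bigr => j _.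
  by rewrite IH; rewrite (negbTE os).
rewrite series_weight_even //; congr (2 * _); apply: eq_bigr => j _.
by rewrite IH (negbNE os).
Qed.

(** The lower bound on [phi] forces it to infinity and fits both cutoffs, 2(n-1) and 2n-1, used
    below. *)
Lemma cvg_series_subseq (R : realType) (f : nat -> R) (phi : nat -> nat) :
  (forall n, (n.-1 <= phi n)%N) -> cvgn (series f) ->
  series f (phi N) @[N --> \oo] --> limn (series f).
Proof.
move=> phin cf; apply: (@cvg_comp _ _ _ phi (series f) \oo \oo) => //.
move=> A [N _ HN]; exists N.+1 => // n /= Nn; apply: HN => /=.
by apply: leq_trans (phin n); lia.
Qed.

Lemma limn_half_subseq (R : realType) (f u : nat -> R) (phi : nat -> nat) :
  (forall n, (n.-1 <= phi n)%N) -> cvgn (series f) ->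
  (forall n, series f (phi n) = 2 * u n) ->
  2 * limn u = limn (series f).
Proof.
move=> phin cf fu.
have -> : u = fun n => 2^-1 * series f (phi n).
  by apply/funext => n; rewrite fu mulKf ?pnatr_eq0.
have /(@cvgMl_tmp _ _ _ _ _ 2^-1) h := cvg_series_subseq phin cf.
by rewrite (cvg_lim _ h) // mulVKf ?pnatr_eq0.
Qed.

(** The exponent lost in c^- is restored by the +1 in the circledast sum, and T_n(1), S_n(1) are
    partial sums of 2/m over the parity opposite to the depth. Up to the factor 2, the defining sums
    are thus a subsequence of the partial sums of [f]. *)
Lemma T_circledast11_decr_last (R : realType) (c : seq nat) :
  admissible c ->
  let f n := term R (rev c) n * series (weight R (size c).+1 1) n in
  cvgn (series f) ->
  T_circledast11 R (decr_last c) = limn (series f).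
Proof.
case/lastP: c => [|c e]; first by rewrite /admissible andbF.
move=> /andP[_]; rewrite last_rcons => e2.
have -> : decr_last (rcons c e) = rcons c e.-1.
  by rewrite /decr_last size_rcons last_rcons /=; elim: (c) => //= x c' ->.
move=> f cf.
have weight1 d : weight R d 1 = fun j => weight R d 1 j * 1.
  by apply/funext => j; rewrite mulr1.
rewrite /T_circledast11 size_rcons last_rcons /= prednK; last by lia.
rewrite -cats1 take_size_cat // /Tsum.
case: ifPn => oc.
  (* For 1 <= m < n the odd numbers 2m-1 are those below 2(n-1); in the even case the numbers 2m are
     the positive even ones below 2n-1. *)
  apply: (limn_half_subseq (phi := fun n => n.-1.*2)) => // [n|n]; first by lia.
  rewrite /f rev_rcons size_rcons /=.
  under eq_fun do rewrite -mulrA.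
  rewrite series_weight_odd ?size_rev //.
  case: n => [|n]; first by rewrite !big_geq.
  congr (2 * _); apply: eq_big_nat => j /andP[j0 _].
  rewrite Tsum_rev_nested size_rev (negbTE oc); congr (_ * _ / _).
  rewrite weight1 series_weight_even /= ?oc // mulr_sumr /Ssum1.
  by apply: eq_bigr => i _; rewrite expr1 mul1r.
apply: (limn_half_subseq (phi := fun n => n.*2.-1)) => // [n|n]; first by lia.
rewrite /f rev_rcons size_rcons /=.
under eq_fun do rewrite -mulrA.
rewrite series_weight_even ?size_rev //.
congr (2 * _); apply: eq_big_nat => j /andP[j0 _].
rewrite !Tsum_rev_nested size_rev /=; move: oc; rewrite negbK => oc.
rewrite oc; congr (_ * _ / _).
rewrite weight1 series_weight_odd ?[RHS]series_weight_odd //= ?oc //.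
Qed.

(** * Convergence against harmonic sums *)

Lemma cvg_series_bound (R : realType) (u : nat -> R) (C : R) :
  (forall n, 0 <= u n) -> (forall n, series u n <= C) -> cvgn (series u).
Proof.
move=> u0 uC; apply: nondecreasing_is_cvgn.
  by apply: nondecreasing_series => n _ _; exact: u0.
by exists C => _ [n _ <-]; exact: uC.
Qed.

Lemma series_ge0 (R : realType) (u : nat -> R) (n : nat) :
  (forall m, 0 <= u m) -> 0 <= series u n.
Proof. by move=> u0; apply: sumr_ge0 => i _; exact: u0. Qed.

(** Mean value bound for t^(p+1) on [b, a]. *)
Lemma exprB_le (R : realType) (a b : R) (p : nat) : 0 <= b -> b <= a ->
  a ^+ p.+1 - b ^+ p.+1 <= p.+1%:R * a ^+ p * (a - b).
Proof.
move=> b0 ba; have a0 := le_trans b0 ba.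
elim: p => [|p IH]; first by rewrite !expr1 expr0 !mul1r.
have -> : a ^+ p.+2 - b ^+ p.+2 =
    a * (a ^+ p.+1 - b ^+ p.+1) + b ^+ p.+1 * (a - b).
  by rewrite !exprS; ring.
have -> : p.+2%:R * a ^+ p.+1 * (a - b) =
    a * (p.+1%:R * a ^+ p * (a - b)) + a ^+ p.+1 * (a - b).
  by rewrite -(natr1 p.+1) exprS; ring.
apply: lerD; first exact: ler_wpM2l.
by apply: ler_wpM2r; [rewrite subr_ge0|rewrite lerXn2r ?nnegrE].
Qed.

Section HarmonicBounds.
Variable R : realType.

(** [harmonic] starts at 1, so [H m] is the harmonic number 1 + 1/2 + ... + 1/m, and [H 0] is 0. *)
Local Notation H := (series (@harmonic R)).

Lemma series_harmonic_ge0 (m : nat) : 0 <= H m.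
Proof. by apply: series_ge0 => n; exact: harmonic_ge0. Qed.

Lemma series_harmonic_le (m n : nat) : (m <= n)%N -> H m <= H n.
Proof.
by apply: nondecreasing_series => k _ _; exact: harmonic_ge0.
Qed.

(** 2/x - 2/(x+1) = 2/(x(x+1)), and x+1 <= 2x once x >= 1. *)
Lemma inv_sqr_le (N : nat) :
  1 / N.+1%:R ^+ 2 + 2 / N.+2%:R <= 2 / N.+1%:R :> R.
Proof.
rewrite -(natr1 N.+1); have : 1 <= N.+1%:R :> R by rewrite ler1n.
move: (N.+1%:R) => x x1; have x0 : x != 0 by lra.
have x10 : x + 1 != 0 by lra.
rewrite -subr_ge0.
have -> : 2 / x - (1 / x ^+ 2 + 2 / (x + 1)) = (x - 1) / (x ^+ 2 * (x + 1)).
  by field; rewrite x0 x10.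
by apply: divr_ge0; [lra|apply: mulr_ge0; [exact: sqr_ge0|lra]].
Qed.

(* Summation by parts, with [1/m^2 <= 2/m - 2/(m+1)], trades one power of the
   harmonic sum for a constant factor; the extra summand is the boundary term. *)
Lemma harmonic_moment_step (p N : nat) :
  series (fun m => H m ^+ p.+1 / m%:R ^+ 2) N.+1 + 2 * H N ^+ p.+1 / N.+1%:R
  <= 2 * p.+1%:R * series (fun m => H m ^+ p / m%:R ^+ 2) N.+1.
Proof.
elim: N => [|N IH].
  (* The summands of index 0 vanish because division by 0 yields 0. *)
  rewrite !seriesSr /series /= !big_geq // !expr0n /= invr0 !mulr0 !mul0r !addr0.
  by rewrite mulr0.
rewrite seriesSr [X in _ <= _ * X]seriesSr mulrDr.
set V := series _ _ in IH *; set W := series _ _ in IH *.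
have HN0 := series_harmonic_ge0 N.
have HS : H N.+1 = H N + N.+1%:R^-1 by rewrite seriesSr.
have HNS : H N <= H N.+1 by exact: series_harmonic_le.
have h1 : H N.+1 ^+ p.+1 - H N ^+ p.+1 <= p.+1%:R * H N.+1 ^+ p / N.+1%:R.
  apply: le_trans (exprB_le p HN0 HNS) _.
  by rewrite HS [X in _ * X]addrC addKr.
have h2 := ler_wpM2l (exprn_ge0 p.+1 (series_harmonic_ge0 N.+1)) (inv_sqr_le N).
have N0 : 0 <= N.+1%:R^-1 :> R by rewrite invr_ge0.
have h3 := ler_wpM2r N0 h1.
rewrite expr2 invfM in h2 *.
(* Adding [IH], [h2] and twice [h3] gives the claim: the boundary terms of [IH] and [h2] leave
   2(a-b)x, which [h3] absorbs. *)
move: IH h2 h3.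
set x := N.+1%:R^-1; set y := N.+2%:R^-1; set a := H N.+1 ^+ p.+1.
set b := H N ^+ p.+1; set c := H N.+1 ^+ p.
nra.
Qed.

(** Bounded partial sums by induction on [p]: the case 0 telescopes, and the step drops the
    nonnegative boundary term of [harmonic_moment_step]. *)
Lemma cvg_harmonic_moment (p : nat) :
  cvgn (series (fun m => H m ^+ p / m%:R ^+ 2)).
Proof.
suff [C HC] : exists C : R, forall N,
    series (fun m => H m ^+ p / m%:R ^+ 2) N.+1 <= C.
  apply: (@cvg_series_bound _ _ C) => [n|n].
    by rewrite divr_ge0 ?exprn_ge0 ?series_harmonic_ge0.
  apply: le_trans (HC n); rewrite seriesSr lerDl.
  by rewrite divr_ge0 ?exprn_ge0 ?series_harmonic_ge0.
elim: p => [|p [C IH]].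
  exists 2 => N; suff : series (fun m => H m ^+ 0 / m%:R ^+ 2) N.+1
      + 2 / N.+1%:R <= 2.
    by apply: le_trans; rewrite lerDl divr_ge0.
  elim: N => [|N IH].
    by rewrite seriesSr /series /= big_geq // expr0n /= invr0 mulr0 !add0r divr1.
  apply: le_trans IH; rewrite seriesSr -addrA lerD2l expr0.
  exact: inv_sqr_le.
exists (2 * p.+1%:R * C) => N.
apply: (@le_trans _ _ (2 * p.+1%:R * series (fun m => H m ^+ p / m%:R ^+ 2) N.+1)).
  apply: le_trans (harmonic_moment_step p N); rewrite lerDl.
  by rewrite divr_ge0 ?mulr_ge0 ?exprn_ge0 ?series_harmonic_ge0.
by apply: ler_wpM2l; rewrite ?mulr_ge0.
Qed.

Lemma weight_ge0 (d e m : nat) : 0 <= weight R d e m.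
Proof. by rewrite /weight; case: ifP => // _; rewrite divr_ge0 ?exprn_ge0. Qed.

Lemma nested_ge0 (rc : seq nat) (m : nat) : 0 <= nested R rc m.
Proof.
elim: rc m => [|e rc IH] m //=.
by apply: series_ge0 => j; rewrite mulr_ge0 ?weight_ge0.
Qed.

Lemma term_ge0 (rc : seq nat) (m : nat) : 0 <= term R rc m.
Proof. by case: rc => //= e rc; rewrite mulr_ge0 ?weight_ge0 ?nested_ge0. Qed.

Lemma weight_le (d e m f : nat) : (f <= e)%N -> weight R d e m <= 2 / m%:R ^+ f.
Proof.
move=> fe; rewrite /weight; case: ifP => [/andP[m0 _]|_]; last first.
  by rewrite divr_ge0 ?exprn_ge0.
apply: ler_wpM2l => //; rewrite lef_pV2 ?posrE ?exprn_gt0 ?ltr0n //.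
by rewrite ler_weXn2l ?ler1n.
Qed.

Lemma series_weight_le (d e m : nat) : (1 <= e)%N ->
  series (weight R d e) m <= 2 * H m.
Proof.
move=> e1; apply: (@le_trans _ _ (series (fun j => 2 / j%:R) m : R)).
  by apply: ler_sum => j _; apply: le_trans (weight_le d j e1) _; rewrite expr1.
case: m => [|m]; first by rewrite /series /= !big_geq // mulr0.
(* The sum over [j < m.+1] has last denominator [m], so it is compared with [H m] before passing to
   [H m.+1]. *)
apply: (@le_trans _ _ (2 * H m)); last first.
  by apply: ler_wpM2l => //; exact: series_harmonic_le.
elim: m => [|m IH]; first by rewrite seriesSr /series /= !big_geq // invr0 !mulr0 addr0.
by rewrite seriesSr [H m.+1]seriesSr mulrDr lerD2r.
Qed.

(** Each layer contributes at most a factor 2 H_m, since the bound on the inner sums increases with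
    their cutoff. *)
Lemma nested_le (rc : seq nat) (m : nat) : all (leq 1) rc ->
  nested R rc m <= (2 * H m) ^+ size rc.
Proof.
elim: rc m => [//|e rc IH] m /= /andP[e1 /IH{}IH].
rewrite exprSr.
apply: (@le_trans _ _ ((2 * H m) ^+ size rc * series (weight R (size rc).+1 e) m)).
  rewrite /series /= mulr_sumr; apply: ler_sum_nat => j /andP[_ jm].
  rewrite mulrC; apply: ler_wpM2r; first exact: weight_ge0.
  apply: le_trans (IH j) _.
  have Hj := series_harmonic_ge0 j.
  rewrite lerXn2r ?nnegrE ?mulr_ge0 ?series_harmonic_ge0 //.
  by apply: ler_wpM2l => //; apply: series_harmonic_le; exact: ltnW.
apply: ler_wpM2l; last exact: series_weight_le.
by rewrite exprn_ge0 // mulr_ge0 // series_harmonic_ge0.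
Qed.

(** As the last exponent is at least 2, a_n <= 2 n^(-2) (2 H_n)^(d-1) for depth d, so a_n H_n is
    dominated by 2^d H_n^d / n^2. *)
Lemma cvg_term_harmonic (c : seq nat) : admissible c ->
  cvgn (series (fun n => term R (rev c) n * H n)).
Proof.
case/lastP: c => [|c e]; first by rewrite /admissible andbF.
rewrite /admissible all_rcons last_rcons rev_rcons => /andP[/andP[_ c1] e2].
have := @is_cvg_seriesZ _ _ (2 ^+ (size c).+1)
  (cvg_harmonic_moment (p := (size c).+1)).
apply: series_le_cvg => n.
- by rewrite mulr_ge0 ?term_ge0 ?series_harmonic_ge0.
- rewrite mulr_ge0 ?exprn_ge0 // divr_ge0 ?exprn_ge0 //.
  exact: series_harmonic_ge0.
have Hn := series_harmonic_ge0 n.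
have -> : (2 ^+ (size c).+1 *: (fun m => H m ^+ (size c).+1 / m%:R ^+ 2)) n
    = 2 / n%:R ^+ 2 * (2 * H n) ^+ size c * H n.
  rewrite -[LHS]/(2 ^+ (size c).+1 * (H n ^+ (size c).+1 / n%:R ^+ 2)).
  by rewrite exprMn 2!exprS; ring.
apply: ler_wpM2r => //; apply: ler_pM; rewrite ?weight_ge0 ?nested_ge0 //.
  exact: weight_le.
by rewrite -(size_rev c) nested_le // all_rev.
Qed.

End HarmonicBounds.

(** * Dominated convergence and the logarithm *)

Lemma series_tail_le (R : realType) (u M : nat -> R) (N : nat) :
  (forall n, `|u n| <= M n) -> cvgn (series M) -> cvgn (series u) ->
  `|limn (series u) - series u N| <= limn (series M) - series M N.
Proof.
move=> uM cM cu.
apply: (ler_cvg_to (cvg_norm (cvgB cu (cvg_cst (series u N))))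
  (cvgB cM (cvg_cst (series M N)))); exists N => // n /= Nn.
rewrite /= -![(_ - _) n]/(_ n - _) !sub_series_geq //.
by apply: le_trans (ler_norm_sum _ _ _) _; apply: ler_sum.
Qed.

Lemma cvg_series_dominated (R : realType) (u M : nat -> R) :
  (forall n, `|u n| <= M n) -> cvgn (series M) -> cvgn (series u).
Proof.
move=> uM cM; apply: normed_cvg; apply: series_le_cvg cM => [n|n|] //.
  exact: normr_ge0.
exact: le_trans (normr_ge0 _) (uM n).
Qed.

(** Tannery's theorem. Beyond a common [N] both tails are bounded by the tail of [M], and the
    remaining finite sums converge termwise. *)
Lemma cvg_series_tannery (R : realType) (T : topologicalType) (F : set_system T)
    {FF : ProperFilter F} (f : T -> nat -> R) (g M : nat -> R) :
  cvgn (series M) -> (\forall x \near F, forall n, `|f x n| <= M n) ->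
  (forall n, f x n @[x --> F] --> g n) ->
  limn (series (f x)) @[x --> F] --> limn (series g).
Proof.
move=> cM fM fg.
have gM n : `|g n| <= M n.
  apply: (ler_cvg_to (cvg_norm (fg n)) (cvg_cst (M n))).
  by apply: filterS fM => x; exact.
have cg := cvg_series_dominated gM cM.
have fgN N : series (f x) N @[x --> F] --> series g N.
  elim: N => [|N IH].
    rewrite {2}/series /= big_geq //.
    under eq_fun do rewrite /series /= big_geq //.
    exact: cvg_cst.
  under eq_fun do rewrite seriesSr.
  by rewrite seriesSr; apply: cvgD.
apply/cvgrPdist_lt => e e0.
have e30 : 0 < e / 3 by rewrite divr_gt0.
have [N _ /(_ N (leqnn N)) HN] := proj1 (cvgrPdist_lt _ _) cM _ e30.
have tN : limn (series M) - series M N < e / 3 by apply: le_lt_trans HN; exact: ler_norm.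
have Hf := proj1 (cvgrPdist_lt _ _) (fgN N) _ e30.
near=> x.
have fxM : forall n, `|f x n| <= M n by near: x.
have h1 := series_tail_le N fxM cM (cvg_series_dominated fxM cM).
have h2 := series_tail_le N gM cM cg.
have h3 : `|series g N - series (f x) N| < e / 3 by near: x; exact: Hf.
have -> : limn (series g) - limn (series (f x)) =
   (limn (series g) - series g N) + (series g N - series (f x) N)
    - (limn (series (f x)) - series (f x) N) by ring.
apply: le_lt_trans (ler_normB _ _) _.
have := ler_normD (limn (series g) - series g N) (series g N - series (f x) N).
lra.
Unshelve. all: by end_near. Qed.

Section LogSeries.
Variable R : realType.

Local Notation H := (series (@harmonic R)).

(** The derivative of ln(1+t) minus its N-th Taylor polynomial is (-t)^N / (1+t), by the geometric
    sum [gs]; the mean value theorem on [0, x] then bounds the error by x^N. *)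
Lemma ln1D_series (x : R) : 0 < x < 1 ->
  series (fun j => (-1) ^+ j * x ^+ j.+1 / j.+1%:R) N @[N --> \oo] --> ln (1 + x).
Proof.
move=> /andP[x0 x1].
pose p (N : nat) (t : R) : R := series (fun j => (-1) ^+ j * t ^+ j.+1 / j.+1%:R) N.
have dp (N : nat) (t : R) : is_derive t 1 (p N) (series (fun j => (- t) ^+ j) N).
  elim: N => [|N IH].
    rewrite (_ : p 0%N = cst 0); last first.
      by apply/funext => y; rewrite /p /series /= big_geq.
    by rewrite /series /= big_geq //; exact: is_derive_cst.
  rewrite (_ : p N.+1 = p N + ((-1) ^+ N / N.+1%:R) \*: (id ^+ N.+1)); last first.
    apply/funext => y; rewrite /p seriesSr; congr (_ + _).
    by rewrite fctE /GRing.scale /= mulrAC; congr (_ * _).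
  rewrite seriesSr; apply: is_deriveD.
  apply: is_derive_eq.
  by rewrite /GRing.scale /= mulr1 mulrA divfK // [RHS]exprNn.
have gs (N : nat) (t : R) : (1 + t) * series (fun j => (- t) ^+ j) N = 1 - (- t) ^+ N.
  elim: N => [|N IH]; first by rewrite /series /= big_geq // expr0 subrr mulr0.
  by rewrite seriesSr mulrDr IH exprS; ring.
have bound (N : nat) : `|ln (1 + x) - p N x| <= x ^+ N.
  pose f (t : R) : R := ln (1 + t) - p N t.
  pose f' (t : R) : R := (1 + t)^-1 - series (fun j => (- t) ^+ j) N.
  have df (t : R) : 0 <= t -> is_derive t 1 f (f' t).
    move=> t0; apply: is_deriveB.
    have t10 : 0 < 1 + t by rewrite ltr_wpDr.
    have dg : is_derive t 1 (fun y : R => 1 + y) 1.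
      by have := is_deriveD (is_derive_cst (1 : R) t 1) (is_derive_id t 1); rewrite add0r.
    have := @is_derive1_comp _ (@ln R) _ _ _ _ (is_derive1_ln t10) dg.
    by rewrite mulr1.
  have [||c /[!in_itv]/= /andP[c0 cx] fc] :=
      MVT_segment (ltW x0) (f := f) (df := f').
  - by move=> t /[!in_itv]/= /andP[/ltW t0 _]; exact: df.
  - apply: derivable_within_continuous => t /[!in_itv]/= /andP[t0 _].
    exact: (@ex_derive _ _ _ _ _ _ _ (df t t0)).
  have f0 : f 0 = 0.
    rewrite /f addr0 ln1 /p /series /= big1 ?subr0 // => j _.
    by rewrite exprS mul0r mulr0 mul0r.
  rewrite -/(f x) -[f x]subr0 -{1}f0 fc subr0.
  have c1 : 0 < 1 + c by lra.
  have -> : f' c = (- c) ^+ N / (1 + c).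
    apply: (mulfI (lt0r_neq0 c1)); rewrite mulrBr gs mulfV ?lt0r_neq0 //.
    rewrite mulrCA mulfV ?lt0r_neq0 //; ring.
  rewrite !normrM normrX normrN normfV (ger0_norm c0) !gtr0_norm //.
  (* Here c^N <= x^N and x / (1+c) <= 1. *)
  rewrite -mulrA -[leRHS]mulr1; apply: ler_pM.
  - exact: exprn_ge0.
  - by rewrite mulr_ge0 ?invr_ge0; lra.
  - by rewrite lerXn2r ?nnegrE // ltW.
  - by rewrite mulrC ler_pdivrMr //; lra.
apply/cvgrPdist_le => e e0.
have x1' : `|x| < 1 by rewrite gtr0_norm.
have Hx := proj1 (cvgrPdist_le _ _) (cvg_expr x1') _ e0.
near=> N; apply: le_trans (bound N) _.
have : `|0 - x ^+ N| <= e by near: N; exact: Hx.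
by rewrite sub0r normrN normrX (gtr0_norm x0).
Unshelve. all: by end_near. Qed.

End LogSeries.

Lemma series_shift (V : zmodType) (u : nat -> V) (n N : nat) :
  series (fun j => u (n + j)%N) N = series u (n + N)%N - series u n.
Proof.
elim: N => [|N IH]; first by rewrite addn0 subrr /series /= big_geq.
by rewrite addnS !seriesSr IH addrAC.
Qed.

(** * The logarithmic singularity at 1 *)

Section LogPart.
Variable R : realType.

Local Notation H := (series (@harmonic R)).

(** For 0 < x < 1 this is log((1+x)/(1-x)) if [d] is odd and -log(1-x^2) if [d] is even. *)
Definition logpart (d : nat) (x : R) : R :=
  limn (series (fun j => weight R d 1 j * x ^+ j)).

(** Partial sums of -log(1-x); doubled, they dominate the partial sums of [logpart] for either
    parity. *)
Let P (x : R) : nat -> R := series (fun j => x ^+ j.+1 / j.+1%:R).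

Lemma cvg_logpart (d : nat) (x : R) : 0 < x < 1 ->
  cvgn (series (fun j => weight R d 1 j * x ^+ j)).
Proof.
move=> /andP[x0 x1].
have x1' : `|x| < 1 by rewrite gtr0_norm.
apply: cvg_series_dominated (is_cvg_geometric_series (a := 2) x1') => n /=.
rewrite ger0_norm; last by rewrite mulr_ge0 ?weight_ge0 ?exprn_ge0 // ltW.
apply: ler_wpM2r; first by rewrite exprn_ge0 // ltW.
by apply: le_trans (weight_le _ _ _ (leq0n 1)) _; rewrite expr0 divr1.
Qed.

Lemma logpart_ge0 (d : nat) (x : R) : 0 < x < 1 -> 0 <= logpart d x.
Proof.
move=> x01; apply: limr_ge; first exact: cvg_logpart.
apply: nearW => N; apply: series_ge0 => m.
by rewrite mulr_ge0 ?weight_ge0 ?exprn_ge0 // ltW //; case/andP: x01.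
Qed.

(** Odd minus even summands form twice the alternating series of log(1+x), up to a shift of the
    index by one. *)
Lemma logpart_diff (d d' : nat) (x : R) : 0 < x < 1 -> odd d -> ~~ odd d' ->
  logpart d x - logpart d' x = 2 * ln (1 + x).
Proof.
move=> x01 od od'.
have c1 := cvg_logpart (d := d) x01; have c2 := cvg_logpart (d := d') x01.
rewrite -lim_seriesB //; apply: cvg_lim => //.
rewrite -(cvg_shiftS (series _)).
have := ln1D_series x01; move=> /(@cvgMl_tmp _ _ _ _ _ 2).
apply: cvg_trans; apply: near_eq_cvg; apply: nearW => N /=.
elim: N => [|N IH].
  rewrite seriesSr /series /= !big_geq // mulr0 add0r.
  rewrite -[RHS]/(weight R d 1 0 * x ^+ 0 - weight R d' 1 0 * x ^+ 0).
  by rewrite /weight /= !mul0r subrr.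
rewrite seriesSr mulrDr IH [in RHS]seriesSr; congr (_ + _).
rewrite -[RHS]/(weight R d 1 N.+1 * x ^+ N.+1 - weight R d' 1 N.+1 * x ^+ N.+1).
rewrite /weight od (negbTE od') /= -signr_odd expr1.
by case: (odd N) => /=; rewrite ?expr1 ?expr0; ring.
Qed.

Lemma series_weight_expr_le (d : nat) (x : R) (N : nat) : 0 < x < 1 ->
  series (fun j => weight R d 1 j * x ^+ j) N <= 2 * P x N.
Proof.
move=> /andP[x0 x1].
have P0 j : 0 <= x ^+ j.+1 / j.+1%:R by rewrite divr_ge0 ?exprn_ge0 // ltW.
case: N => [|N]; first by rewrite /P /series /= !big_geq // mulr0.
apply: (@le_trans _ _ (2 * P x N)); last first.
  by apply: ler_wpM2l => //; rewrite /P seriesSr lerDl.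
rewrite /P.
elim: N => [|N IH].
  by rewrite seriesSr /series /= !big_geq // mulr0 add0r /weight /= mul0r.
rewrite seriesSr [X in _ <= _ * X]seriesSr mulrDr; apply: lerD => //.
rewrite mulrCA mulrC; apply: ler_wpM2l; first by rewrite exprn_ge0 // ltW.
by apply: le_trans (weight_le _ _ _ (leqnn 1)) _; rewrite expr1.
Qed.

(* [x^n * x^(j+1) / (j+1)] is at least the summand of index [j+n], so the sum
   telescopes up to its first [n] summands. *)
Lemma powersum_harmonic (x : R) (n N : nat) : 0 < x < 1 ->
  P x N * (1 - x ^+ n) <= H n.
Proof.
move=> /andP[x0 x1].
have u0 j : 0 <= x ^+ j.+1 / j.+1%:R by rewrite divr_ge0 ?exprn_ge0 // ltW.
have Pn : P x n <= H n.
  apply: ler_sum => j _; rewrite -[leRHS]mul1r.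
  by apply: ler_wpM2r => //; rewrite exprn_ile1 // ltW.
have PN : P x N <= P x (n + N)%N.
  by apply: nondecreasing_series => [j _ _|]; [exact: u0|rewrite leq_addl].
have := series_shift (fun j => x ^+ j.+1 / j.+1%:R) n N; rewrite -!/(P _ _).
set S := series _ _ => HS.
suff : S <= P x N * x ^+ n by move: PN Pn HS; lra.
rewrite /S /P /series /= mulr_suml; apply: ler_sum => j _.
rewrite mulrAC -exprD addSn addnC; apply: ler_wpM2l.
  by rewrite exprn_ge0 // ltW.
by rewrite lef_pV2 ?posrE ?ltr0n // ler_nat; lia.
Qed.

(* The first [K] summands are at most 1, the others at most [x^j / (K+1)]. *)
Lemma powersum_small (x : R) (K N : nat) : 0 < x < 1 ->
  P x N * (1 - x) <= K%:R * (1 - x) + K.+1%:R^-1.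
Proof.
move=> /andP[x0 x1].
have u0 j : 0 <= x ^+ j.+1 / j.+1%:R by rewrite divr_ge0 ?exprn_ge0 // ltW.
have PK : P x K <= K%:R.
  apply: (@le_trans _ _ (\sum_(0 <= j < K) 1)); last first.
    by rewrite sumr_const_nat subn0.
  apply: ler_sum => j _; rewrite ler_pdivrMr ?ltr0n // mul1r.
  by apply: (@le_trans _ _ 1); [rewrite exprn_ile1 // ltW|rewrite ler1n].
have PN : P x N <= P x (K + N)%N.
  by apply: nondecreasing_series => [j _ _|]; [exact: u0|rewrite leq_addl].
have := series_shift (fun j => x ^+ j.+1 / j.+1%:R) K N; rewrite -!/(P _ _).
set S := series _ _ => HS.
have SG : S * (1 - x) <= K.+1%:R^-1.
  have : S <= series (fun j => x ^+ j) N / K.+1%:R.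
    rewrite /S /P /series /= mulr_suml; apply: ler_sum => j _.
    apply: ler_pM; rewrite ?invr_ge0 ?exprn_ge0 ?(ltW x0) //.
      by rewrite ler_wiXn2l ?ltW //; lia.
    by rewrite lef_pV2 ?posrE ?ltr0n // ler_nat; lia.
  have x10 : 0 <= 1 - x by lra.
  move=> /(ler_wpM2r x10) /le_trans; apply.
  rewrite mulrAC -[leRHS]mul1r; apply: ler_wpM2r => //.
  suff -> : series (fun j => x ^+ j) N * (1 - x) = 1 - x ^+ N.
    by rewrite gerBl exprn_ge0 // ltW.
  elim: N {PN HS S} => [|N IH]; first by rewrite /series /= big_geq // mul0r expr0 subrr.
  by rewrite seriesSr mulrDl IH exprS; ring.
have x10 : 0 <= 1 - x by lra.
have : P x N * (1 - x) <= (K%:R + S) * (1 - x).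
  by apply: ler_wpM2r => //; move: PN PK HS; lra.
by move=> /le_trans; apply; rewrite mulrDl lerD2l.
Qed.

Lemma logpart_le (d : nat) (x c B : R) : 0 < x < 1 -> 0 <= c ->
  (forall N, P x N * c <= B) -> logpart d x * c <= 2 * B.
Proof.
move=> x01 c0 PB.
apply: (ler_cvg_to (cvgMr_tmp (b := c) (cvg_logpart (d := d) x01)) (cvg_cst (2 * B))).
apply: nearW => N.
apply: (@le_trans _ _ (2 * P x N * c)); last by rewrite -mulrA ler_wpM2l.
by apply: ler_wpM2r => //; exact: series_weight_expr_le.
Qed.

Lemma logpart_harmonic (d n : nat) (x : R) : 0 < x < 1 ->
  logpart d x * (1 - x ^+ n) <= 2 * H n.
Proof.
move=> x01; apply: logpart_le => // [|N]; last exact: powersum_harmonic.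
by case/andP: x01 => x0 x1; rewrite subr_ge0 exprn_ile1 // ltW.
Qed.

Lemma near_left_itv (e : R) : 0 < e -> \forall x \near 1^'-, 0 < x < 1 /\ 1 - x < e.
Proof.
move=> e0; near=> x; split; last first.
  have : 1 - e < x by near: x; apply: nbhs_left_gt; lra.
  lra.
apply/andP; split; near: x; first by apply: nbhs_left_gt.
exact: nbhs_left_lt.
Unshelve. all: by end_near. Qed.

(** The case n = 1 suffices, because 1 - x^n <= n(1-x). *)
Lemma cvg_logpart_pow (d n : nat) :
  logpart d x * (1 - x ^+ n) @[x --> 1^'-] --> 0.
Proof.
have h : logpart d x * (1 - x) @[x --> 1^'-] --> 0.
  apply/cvgrPdist_lt => e e0.
  (* With 1/(K+1) < e/4 and (K+1)(1-x) < e/4, the bound 2(K(1-x) + 1/(K+1)) is below e. *)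
  have e40 : 0 < e / 4 by rewrite divr_gt0.
  have [K _ /(_ K (leqnn K))] := proj1 (cvgrPdist_lt _ _) (@cvg_harmonic R) _ e40.
  rewrite sub0r normrN ger0_norm ?harmonic_ge0 // => HK.
  have e4K : 0 < e / 4 / K.+1%:R by rewrite divr_gt0.
  near=> x.
  have [x01 xe] : 0 < x < 1 /\ 1 - x < e / 4 / K.+1%:R.
    by near: x; exact: near_left_itv.
  have x10 : 0 <= 1 - x by case/andP: x01; lra.
  rewrite sub0r normrN ger0_norm ?mulr_ge0 ?logpart_ge0 //.
  have := logpart_le d x01 x10 (fun N => powersum_small K N x01).
  move: xe; rewrite ltr_pdivlMr ?ltr0n // -natr1 => xe.
  by move: HK; rewrite /harmonic /= -natr1; nra.
rewrite (_ : 0 = 0 * n%:R); last by rewrite mul0r.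
apply: (@squeeze_cvgr _ _ _ _ (fun=> 0) (fun x => logpart d x * (1 - x) * n%:R)).
- near=> x.
  have [x01 _] : 0 < x < 1 /\ 1 - x < 1 by near: x; exact: near_left_itv.
  have /andP[x0 x1] := x01.
  have xn : 0 <= 1 - x ^+ n by rewrite subr_ge0 exprn_ile1 // ltW.
  rewrite mulr_ge0 ?logpart_ge0 //= -mulrA ler_wpM2l ?logpart_ge0 //.
  case: n xn => [|n] _; first by rewrite expr0 subrr mulr0.
  have := exprB_le n (ltW x0) (ltW x1).
  by rewrite !expr1n mulr1 mulrC.
- by rewrite mul0r; exact: cvg_cst.
- exact: cvgMr_tmp.
Unshelve. all: by end_near. Qed.

End LogPart.

(** * Behaviour at the left of 1 *)

Lemma cvg_left_expr (R : realType) (n : nat) : x ^+ n @[x --> (1 : R)^'-] --> (1 : R).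
Proof.
apply: cvg_at_left_filter; rewrite -[X in _ --> X](expr1n R n).
exact: exprn_continuous.
Qed.

(** * Abel-type limits for a coefficient sequence *)

Section Abel.
Variables (R : realType) (a : nat -> R) (d : nat).
Hypothesis a_ge0 : forall n, 0 <= a n.
Hypothesis a_0 : a 0%N = 0.
(** In the application [a] and the weights live on opposite parities, so the product of the two
    series has no diagonal terms. *)
Hypothesis a_weight : forall n, a n * weight R d 1 n = 0.
Hypothesis cvg_a_harmonic : cvgn (series (fun n => a n * series (@harmonic R) n)).

Local Notation H := (series (@harmonic R)).
Let b := weight R d 1.

(** H_n >= 1 for n >= 1; at n = 0, where H_0 = 0, [a_0] takes over. *)
Lemma cvg_series_coef : cvgn (series a).
Proof.
apply: cvg_series_dominated cvg_a_harmonic => -[|n].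
  by rewrite a_0 normr0 mul0r.
rewrite ger0_norm // -[leLHS]mulr1; apply: ler_wpM2l => //.
have := @series_harmonic_le R 1 n.+1 (ltn0Sn n).
by rewrite [H 1]seriesSr /series /= big_geq // add0r /harmonic invr1.
Qed.

Lemma cvg_power_series_coef (x : R) : 0 < x < 1 ->
  cvgn (series (fun n => a n * x ^+ n)).
Proof.
move=> /andP[x0 x1]; apply: cvg_series_dominated cvg_series_coef => n.
rewrite ger0_norm; last by rewrite mulr_ge0 ?exprn_ge0 // ltW.
by rewrite ler_piMr // exprn_ile1 // ltW.
Qed.

Lemma abel_coef :
  limn (series (fun n => a n * x ^+ n)) @[x --> 1^'-] --> limn (series a).
Proof.
apply: (cvg_series_tannery cvg_series_coef) => [|n]; last first.
  by rewrite -[X in _ --> X]mulr1; apply: cvgMl_tmp; exact: cvg_left_expr.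
near=> x => n.
have [/andP[x0 x1] _] : 0 < x < 1 /\ 1 - x < 1 by near: x; exact: near_left_itv.
rewrite ger0_norm; last by rewrite mulr_ge0 ?exprn_ge0 // ltW.
by rewrite ler_piMr // exprn_ile1 // ltW.
Unshelve. all: by end_near. Qed.

(** The product is the sum of a_n L(x)(1-x^n), whose terms tend to 0 under the majorant 2 a_n H_n.
    The parity [d'] is free because the remainder of one index will meet the logarithm of the
    other. *)
Lemma abel_remainder_logpart (d' : nat) :
  (limn (series a) - limn (series (fun n => a n * x ^+ n))) * logpart d' x
    @[x --> 1^'-] --> 0.
Proof.
have cM := @is_cvg_seriesZ _ _ 2 cvg_a_harmonic.
have lim0 : limn (series (fun=> 0 : R)) = 0.
  rewrite (_ : series _ = fun=> 0); first exact: lim_cst.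
  by apply/funext => n; rewrite /series /= big1.
have h : limn (series (fun n => a n * (logpart d' x * (1 - x ^+ n))))
    @[x --> 1^'-] --> (0 : R).
  rewrite -lim0; apply: (cvg_series_tannery cM) => [|n]; last first.
    rewrite -[X in _ --> X](mulr0 (a n)); apply: cvgMl_tmp.
    exact: cvg_logpart_pow.
  near=> x => n.
  have [x01 _] : 0 < x < 1 /\ 1 - x < 1 by near: x; exact: near_left_itv.
  have /andP[x0 x1] := x01.
  have xn : 0 <= 1 - x ^+ n by rewrite subr_ge0 exprn_ile1 // ltW.
  rewrite ger0_norm ?mulr_ge0 ?logpart_ge0 //.
  rewrite -[leRHS]/(2 * (a n * H n)) [leRHS]mulrCA.
  by apply: ler_wpM2l => //; exact: logpart_harmonic.
apply: cvg_trans h; apply: near_eq_cvg; near=> x.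
have [x01 _] : 0 < x < 1 /\ 1 - x < 1 by near: x; exact: near_left_itv.
rewrite -lim_seriesB; [|exact: cvg_series_coef|exact: cvg_power_series_coef].
apply: cvg_lim => //.
have cB := is_cvg_seriesB cvg_series_coef (cvg_power_series_coef x01).
apply: cvg_trans (cvgMr_tmp (b := logpart d' x) cB).
apply: near_eq_cvg; apply: nearW => N.
rewrite /series /= mulr_suml; apply: eq_bigr => n _.
rewrite -[X in X * _ = _]/(a n - a n * x ^+ n); ring.
Unshelve. all: by end_near. Qed.

(* Cutting the square of index pairs along its diagonal, at finite level, spares
   any exchange of infinite sums. *)
Lemma sum_square_split (w : nat -> R) (N : nat) : (forall n, a n * w n = 0) ->
  series (fun n => a n * series w n) N + series (fun m => w m * series a m) N
  = series a N * series w N.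
Proof.
move=> aw; elim: N => [|N IH]; first by rewrite /series /= !big_geq // mulr0 addr0.
rewrite !seriesSr mulrDl !mulrDr -IH aw; ring.
Qed.

(** Limit of [sum_square_split] with w_m = b_m x^m. Only the largest variable carries a power of x,
    so [series a m] appears without one. *)
Lemma abel_product (x : R) : 0 < x < 1 ->
  limn (series (fun m => b m * series a m * x ^+ m)) =
  limn (series a) * logpart d x
  - limn (series (fun n => a n * series (fun m => b m * x ^+ m) n)).
Proof.
move=> x01; have /andP[x0 x1] := x01.
pose w m := b m * x ^+ m.
have w0 m : 0 <= w m by rewrite mulr_ge0 ?weight_ge0 ?exprn_ge0 // ltW.
have cD : cvgn (series (fun n => a n * series w n)).
  apply: cvg_series_dominated (@is_cvg_seriesZ _ _ 2 cvg_a_harmonic) => n.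
  rewrite ger0_norm ?mulr_ge0 ?series_ge0 //.
  rewrite -[leRHS]/(2 * (a n * H n)) [leRHS]mulrCA; apply: ler_wpM2l => //.
  apply: le_trans (series_weight_le R d n (leqnn 1)); apply: ler_sum => j _.
  by rewrite ler_piMr ?weight_ge0 // exprn_ile1 // ltW.
apply: cvg_lim => //.
apply: cvg_trans (cvgB (cvgM cvg_series_coef (cvg_logpart (d := d) x01)) cD).
apply: near_eq_cvg; apply: nearW => N.
have aw n : a n * w n = 0 by rewrite mulrA a_weight mul0r.
rewrite -[LHS]/(series a N * series w N - series (fun n => a n * series w n) N).
rewrite -(sum_square_split N aw) addrC addKr.
by congr (series _ N); apply/funext => m; rewrite mulrAC.
Qed.

(** The inner sums are finite and at most 2 H_n uniformly in x, so 2 a_n H_n is a majorant. *)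
Lemma abel_correction :
  limn (series (fun n => a n * series (fun m => b m * x ^+ m) n))
    @[x --> 1^'-] --> limn (series (fun n => a n * series b n)).
Proof.
apply: (cvg_series_tannery (@is_cvg_seriesZ _ _ 2 cvg_a_harmonic)) => [|n].
  near=> x => n.
  have [/andP[x0 x1] _] : 0 < x < 1 /\ 1 - x < 1 by near: x; exact: near_left_itv.
  have w0 m : 0 <= b m * x ^+ m by rewrite mulr_ge0 ?weight_ge0 ?exprn_ge0 // ltW.
  rewrite ger0_norm ?mulr_ge0 ?series_ge0 //.
  rewrite -[leRHS]/(2 * (a n * H n)) [leRHS]mulrCA; apply: ler_wpM2l => //.
  apply: le_trans (series_weight_le R d n (leqnn 1)); apply: ler_sum => j _.
  by rewrite ler_piMr ?weight_ge0 // exprn_ile1 // ltW.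
apply: cvgMl_tmp; elim: n => [|n IH].
  rewrite {2}/series /= big_geq //.
  under eq_fun do rewrite /series /= big_geq //.
  exact: cvg_cst.
under eq_fun do rewrite seriesSr.
rewrite seriesSr; apply: cvgD => //.
by rewrite -[X in _ --> X]mulr1; apply: cvgMl_tmp; exact: cvg_left_expr.
Unshelve. all: by end_near. Qed.

Lemma cvg_correction : cvgn (series (fun n => a n * series b n)).
Proof.
apply: cvg_series_dominated (@is_cvg_seriesZ _ _ 2 cvg_a_harmonic) => n.
rewrite ger0_norm ?mulr_ge0 ?series_ge0 // => [|m]; last exact: weight_ge0.
rewrite -[leRHS]/(2 * (a n * H n)) [leRHS]mulrCA; apply: ler_wpM2l => //.
exact: series_weight_le.
Qed.

End Abel.

Lemma term_0 (R : realType) (rc : seq nat) : term R rc 0 = 0.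
Proof. by case: rc => //= e rc; rewrite /weight /= mul0r. Qed.

(** * Application to admissible indices *)

Section Indices.
Variables (R : realType) (c : seq nat).
Hypothesis c_adm : admissible c.

(** The largest variable has the parity of the depth, the weight that of the depth plus one. *)
Lemma term_weight (n : nat) : term R (rev c) n * weight R (size c).+1 1 n = 0.
Proof.
rewrite -(size_rev c); case: (rev c) => [|e rc] /=; first by rewrite mul0r.
rewrite /weight /= negbK; case: (odd n); case: (odd (size rc));
  by rewrite /= ?andbF ?mulr0 ?mul0r.
Qed.

Lemma admissible_size : (0 < size c)%N.
Proof. by case: c c_adm. Qed.

Let c_harm := cvg_term_harmonic (R := R) c_adm.

Lemma Afun_rcons1 (x : R) : 0 < x < 1 ->
  Afun (rcons c 1%N) x = Tval R c * logpart (size c).+1 x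
    - limn (series (fun n => term R (rev c) n
        * series (fun m => weight R (size c).+1 1 m * x ^+ m) n)).
Proof.
move=> x01; rewrite AfunE ?size_rcons // TvalE ?admissible_size //.
rewrite -(abel_product (term_ge0 R _) (term_0 R _) term_weight c_harm x01).
rewrite rev_rcons /= size_rev nested_term // size_rev; exact: admissible_size.
Qed.

Lemma cvg_Afun : Afun c x @[x --> (1 : R)^'-] --> Tval R c.
Proof.
under eq_fun do rewrite AfunE ?admissible_size //.
rewrite TvalE ?admissible_size //.
exact: (abel_coef (term_ge0 R _) (term_0 R _) c_harm).
Qed.

Lemma Afun_logpart (d : nat) :
  (Tval R c - Afun c x) * logpart d x @[x --> (1 : R)^'-] --> 0.
Proof.
under eq_fun do rewrite AfunE ?admissible_size //.
rewrite TvalE ?admissible_size //.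
exact: (abel_remainder_logpart (term_ge0 R _) (term_0 R _) c_harm).
Qed.

Lemma cvg_T_circledast11 :
  limn (series (fun n => term R (rev c) n
      * series (fun m => weight R (size c).+1 1 m * x ^+ m) n))
    @[x --> (1 : R)^'-] --> T_circledast11 R (decr_last c).
Proof.
rewrite T_circledast11_decr_last //; last first.
  exact: (cvg_correction (term_ge0 R _) c_harm).
exact: (abel_correction (term_ge0 R _) c_harm).
Qed.

End Indices.

(** [logpart] takes the depth plus one, so for odd r and even s the difference is odd part minus
    even part, with sign +1. For equal parities the two functions coincide. *)
Lemma cvg_logpart_diff (R : realType) (r s : nat) :
  logpart s.+1 x - logpart r.+1 x @[x --> (1 : R)^'-] -->
    2 * delta R r s * ln 2.
Proof.
have ln12 : ln (1 + x) @[x --> (1 : R)^'-] --> (ln 2 : R).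
  apply: cvg_at_left_filter.
  apply: (@cvg_comp _ _ _ (fun x : R => 1 + x) (@ln R) _ (nbhs (2 : R))).
    by apply: cvgD; [exact: cvg_cst|exact: cvg_id].
  by apply: continuous_ln.
have near01 : \forall x \near (1 : R)^'-, 0 < x < 1.
  by apply: filterS (@near_left_itv R 1 ltr01) => x [].
rewrite /delta; case: ifPn => [/eqP rs|rs].
  rewrite mulr0 mul0r; under eq_fun do rewrite /logpart /weight /= rs subrr.
  exact: cvg_cst.
have [or|er] := boolP (odd r).
  rewrite mulr1; apply: cvg_trans (cvgMl_tmp (a := 2) ln12).
  apply: near_eq_cvg; apply: filterS near01 => x x01.
  by rewrite (logpart_diff x01) //= ?negbK //; case: (odd s) rs; rewrite or.
rewrite mulrN1 mulNr; apply: cvg_trans (cvgN (cvgMl_tmp (a := 2) ln12)).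
apply: near_eq_cvg; apply: filterS near01 => x x01.
rewrite -[LHS]/(- (2 * ln (1 + x))) -(@logpart_diff _ r.+1 s.+1 x x01) ?opprB //=.
by rewrite negbK; case: (odd s) rs; rewrite (negbTE er).
Qed.

Theorem theorem3p7 (R : realType) (r s : nat) (hr : (1 <= r)%N) (hs : (1 <= s)%N)
    (k : r.-tuple nat) (l : s.-tuple nat)
    (hk : admissible k) (hl : admissible l) :
  (Afun k x * Afun (rcons l 1%N) x - Afun (rcons k 1%N) x * Afun l x) @[x --> (1 : R)^'-] -->
    Tval R l * T_circledast11 R (decr_last k) - Tval R k * T_circledast11 R (decr_last l)
      + 2 * delta R r s * ln 2 * Tval R k * Tval R l.
Proof.
pose D (c : seq nat) (x : R) : R := limn (series (fun n => term R (rev c) n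
    * series (fun m => weight R (size c).+1 1 m * x ^+ m) n)).
have Dk : D k x @[x --> (1 : R)^'-] --> T_circledast11 R (decr_last k).
  exact: cvg_T_circledast11.
have Dl : D l x @[x --> (1 : R)^'-] --> T_circledast11 R (decr_last l).
  exact: cvg_T_circledast11.
have Ak := cvg_Afun (R := R) hk; have Al := cvg_Afun (R := R) hl.
have Lk := Afun_logpart (R := R) hk s.+1; have Ll := Afun_logpart (R := R) hl r.+1.
have L := @cvg_logpart_diff R r s.
(* The two zeros are the limits of the remainders in [Ll] and [Lk]. *)
rewrite [X in _ --> X](_ : _ =
    Tval R l * T_circledast11 R (decr_last k)
    - Tval R k * T_circledast11 R (decr_last l)
    + (0 * Tval R k - 0 * Tval R l + 2 * delta R r s * ln 2 * (Tval R k * Tval R l)));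
  last by ring.
apply: cvg_trans (cvgD (cvgB (cvgM Al Dk) (cvgM Ak Dl))
  (cvgD (cvgB (cvgMr_tmp (b := Tval R k) Ll) (cvgMr_tmp (b := Tval R l) Lk))
        (cvgMr_tmp (b := Tval R k * Tval R l) L))).
apply: near_eq_cvg.
apply: filterS (@near_left_itv R 1 ltr01) => x [x01 _].
rewrite !Afun_rcons1 // !size_tuple /D.
(* Adding and subtracting T(k)T(l)L_r and T(k)T(l)L_s pairs each logarithm with a vanishing
   remainder of the other index, leaving only L_s - L_r. *)
rewrite -[LHS]/(Afun l x * D k x - Afun k x * D l x +
  ((Tval R l - Afun l x) * logpart r.+1 x * Tval R k
   - (Tval R k - Afun k x) * logpart s.+1 x * Tval R l
   + (logpart s.+1 x - logpart r.+1 x) * (Tval R k * Tval R l))).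
rewrite /D !size_tuple; ring.
Qed.
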